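(* Let $\mathcal C$ be a locally small monoidal category with pushouts, let $(H,\Delta,\varepsilon)$ be a coalgebra in $\mathcal C$ and let $(X,\partial_X)$ be a counital (not necessarily coassociative) right $H$-comodule in $\mathcal C$, i.e. $\partial_X:X\to X\otimes H$ satisfies $(X\otimes\varepsilon)\circ\partial_X=\mathrm{Id}_X$. If a morphism $\pi_X:X\otimes H\to X\bullet H$ exists that universally coequalizes $(\partial_X\otimes H)\circ\partial_X$ and $(X\otimes\Delta)\circ\partial_X$ (in the sense defined in the context), then $(X,X\bullet H,\pi_X,\pi_X\circ\partial_X)$ is a geometric partial $H$-comodule.
   Context: The monoidal category $(\mathcal C,\otimes,\mathbb I)$ is written as if strict; the identity of an object $X$ is again denoted $X$. A pair $(X\bullet H,\pi_X)$ with $\pi_X:X\otimes H\to X\bullet H$ is said to universally coequalize if $(\pi_X\otimes H)\circ(\partial_X\otimes H)\circ\partial_X=(\pi_X\otimes H)\circ(X\otimes\Delta)\circ\partial_X$ and, for every object $T$ and morphism $t:X\otimes H\to T$ with $(t\otimes H)\circ(\partial_X\otimes H)\circ\partial_X=(t\otimes H)\circ(X\otimes\Delta)\circ\partial_X$, there is a unique $u:X\bullet H\to T$ with $t=u\circ\pi_X$. (Such a $\pi_X$ is automatically an epimorphism.) A partial comodule datum over $H$ is $(X,X\bullet H,\pi_X,\rho_X)$ with $\rho_X:X\to X\bullet H$ a morphism and $\pi_X:X\otimes H\to X\bullet H$ an epimorphism. Let $(X\bullet H)\bullet H$, with morphisms $\rho_X\bullet H:X\bullet H\to (X\bullet H)\bullet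 H$ and $\pi_{X\bullet H}:(X\bullet H)\otimes H\to (X\bullet H)\bullet H$, be the pushout of $\pi_X$ and $\rho_X\otimes H$. Let $X\bullet(H\bullet H)$, with morphisms $X\bullet\Delta:X\bullet H\to X\bullet(H\bullet H)$ and $\pi_{X,\Delta}:(X\bullet H)\otimes H\to X\bullet(H\bullet H)$, be the pushout of $\pi_X$ and $(\pi_X\otimes H)\circ(X\otimes\Delta)$. The datum is a geometric partial comodule if: (GPC1) there is $X\bullet\varepsilon:X\bullet H\to X$ with $(X\bullet\varepsilon)\circ\rho_X=\mathrm{Id}_X$ and $(X\bullet\varepsilon)\circ\pi_X=X\otimes\varepsilon$; (GPC2) there is an isomorphism $\theta:X\bullet(H\bullet H)\to (X\bullet H)\bullet H$ with $\theta\circ\pi_{X,\Delta}=\pi_{X\bullet H}$ and $\theta\circ(X\bullet\Delta)\circ\rho_X=(\rho_X\bullet H)\circ\rho_X$. *)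

(* Defs.v *)
Set Implicit Arguments.
Unset Strict Implicit.
Unset Printing Implicit Defensive.

Declare Scope cat_scope.
Delimit Scope cat_scope with cat.
Open Scope cat_scope.

Reserved Notation "X --> Y" (at level 70, no associativity).
Reserved Notation "g ∘ f" (at level 40, left associativity).
Reserved Notation "X ⊗ Y" (at level 35, right associativity).
Reserved Notation "f ⊠ g" (at level 35, right associativity).

(* Local smallness is built in: between any two objects the morphisms form a
   single type, whose universe is independent of that of the objects. *)
Record category := Category {
  obj :> Type;
  hom : obj -> obj -> Type where "X --> Y" := (hom X Y);
  idm : forall X : obj, X --> X;
  comp : forall X Y Z : obj, Y --> Z -> X --> Y -> X --> Z
    where "g ∘ f" := (comp g f);
  comp_idl : forall (X Y : obj) (f : X --> Y), idm Y ∘ f = f;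
  comp_idr : forall (X Y : obj) (f : X --> Y), f ∘ idm X = f;
  comp_assoc : forall (X Y Z W : obj) (h : Z --> W) (g : Y --> Z) (f : X --> Y),
    h ∘ (g ∘ f) = (h ∘ g) ∘ f
}.

Arguments hom {_} X Y.
Arguments idm {_} X.
Arguments comp {_ X Y Z} g f.

Notation "X --> Y" := (hom X Y) : cat_scope.
Notation "g ∘ f" := (comp g f) : cat_scope.

Definition is_iso (C : category) (X Y : C) (f : X --> Y) : Prop :=
  exists g : Y --> X, g ∘ f = idm X /\ f ∘ g = idm Y.

Definition epi (C : category) (X Y : C) (f : X --> Y) : Prop :=
  forall (T : C) (u v : Y --> T), u ∘ f = v ∘ f -> u = v.

Record is_pushout (C : category) (A B D : C) (f : A --> B) (g : A --> D)
    (P : C) (i : B --> P) (j : D --> P) : Prop := IsPushout {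
  pushout_comm : i ∘ f = j ∘ g;
  pushout_univ : forall (T : C) (b : B --> T) (d : D --> T),
    b ∘ f = d ∘ g ->
    exists! u : P --> T, u ∘ i = b /\ u ∘ j = d
}.

Record pushout (C : category) (A B D : C) (f : A --> B) (g : A --> D) := Pushout {
  po_obj : C;
  po_inl : B --> po_obj;
  po_inr : D --> po_obj;
  po_is_pushout : is_pushout f g po_inl po_inr
}.

Definition pushouts_in (C : category) : Type :=
  forall (A B D : C) (f : A --> B) (g : A --> D), pushout f g.

(* Not assumed strict. *)
Record monoidal_category := MonoidalCategory {
  cat_of :> category;
  unit_obj : cat_of;
  tens : cat_of -> cat_of -> cat_of where "X ⊗ Y" := (tens X Y);
  tensm : forall X Y X' Y' : cat_of, X --> X' -> Y --> Y' -> X ⊗ Y --> X' ⊗ Y'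
    where "f ⊠ g" := (tensm f g);
  assoc : forall X Y Z : cat_of, (X ⊗ Y) ⊗ Z --> X ⊗ (Y ⊗ Z);
  assoc_inv : forall X Y Z : cat_of, X ⊗ (Y ⊗ Z) --> (X ⊗ Y) ⊗ Z;
  lunit : forall X : cat_of, unit_obj ⊗ X --> X;
  lunit_inv : forall X : cat_of, X --> unit_obj ⊗ X;
  runit : forall X : cat_of, X ⊗ unit_obj --> X;
  runit_inv : forall X : cat_of, X --> X ⊗ unit_obj;
  tensm_id : forall X Y : cat_of, idm X ⊠ idm Y = idm (X ⊗ Y);
  tensm_comp : forall (X Y Z X' Y' Z' : cat_of)
    (g : Y --> Z) (f : X --> Y) (g' : Y' --> Z') (f' : X' --> Y'),
    (g ∘ f) ⊠ (g' ∘ f') = (g ⊠ g') ∘ (f ⊠ f');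
  assocK : forall X Y Z : cat_of, assoc_inv X Y Z ∘ assoc X Y Z = idm _;
  assoc_invK : forall X Y Z : cat_of, assoc X Y Z ∘ assoc_inv X Y Z = idm _;
  lunitK : forall X : cat_of, lunit_inv X ∘ lunit X = idm _;
  lunit_invK : forall X : cat_of, lunit X ∘ lunit_inv X = idm _;
  runitK : forall X : cat_of, runit_inv X ∘ runit X = idm _;
  runit_invK : forall X : cat_of, runit X ∘ runit_inv X = idm _;
  assoc_nat : forall (X Y Z X' Y' Z' : cat_of)
    (f : X --> X') (g : Y --> Y') (h : Z --> Z'),
    assoc X' Y' Z' ∘ ((f ⊠ g) ⊠ h) = (f ⊠ (g ⊠ h)) ∘ assoc X Y Z;
  lunit_nat : forall (X Y : cat_of) (f : X --> Y),
    lunit Y ∘ (idm unit_obj ⊠ f) = f ∘ lunit X;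
  runit_nat : forall (X Y : cat_of) (f : X --> Y),
    runit Y ∘ (f ⊠ idm unit_obj) = f ∘ runit X;
  triangle : forall X Y : cat_of,
    (idm X ⊠ lunit Y) ∘ assoc X unit_obj Y = runit X ⊠ idm Y;
  pentagon : forall X Y Z W : cat_of,
    assoc X Y (Z ⊗ W) ∘ assoc (X ⊗ Y) Z W =
    (idm X ⊠ assoc Y Z W) ∘ assoc X (Y ⊗ Z) W ∘ (assoc X Y Z ⊠ idm W)
}.

Arguments unit_obj {_}.
Arguments tens {_} X Y.
Arguments tensm {_ X Y X' Y'} f g.
Arguments assoc {_} X Y Z.
Arguments assoc_inv {_} X Y Z.
Arguments lunit {_} X.
Arguments lunit_inv {_} X.
Arguments runit {_} X.
Arguments runit_inv {_} X.

Notation "X ⊗ Y" := (tens X Y) : cat_scope.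
Notation "f ⊠ g" := (tensm f g) : cat_scope.

Record coalgebra (C : monoidal_category) := Coalgebra {
  carrier :> C;
  comul : carrier --> carrier ⊗ carrier;
  counit : carrier --> unit_obj;
  comul_coassoc :
    assoc carrier carrier carrier ∘ (comul ⊠ idm carrier) ∘ comul =
    (idm carrier ⊠ comul) ∘ comul;
  comul_counitl : lunit carrier ∘ (counit ⊠ idm carrier) ∘ comul = idm carrier;
  comul_counitr : runit carrier ∘ (idm carrier ⊠ counit) ∘ comul = idm carrier
}.

Arguments comul {_} H : rename.
Arguments counit {_} H : rename.

Section Comodules.
Variables (C : monoidal_category) (H : coalgebra C).

(* X ⊗ Δ and X ⊗ ε, with the coherence isomorphisms that strictness would
   suppress: they land in (X ⊗ H) ⊗ H and in X. *)
Definition tens_comul (X : C) : X ⊗ H --> (X ⊗ H) ⊗ H :=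
  assoc_inv X H H ∘ (idm X ⊠ comul H).

Definition tens_counit (X : C) : X ⊗ H --> X :=
  runit X ∘ (idm X ⊠ counit H).

Definition counital (X : C) (dX : X --> X ⊗ H) : Prop :=
  tens_counit X ∘ dX = idm X.

Definition coequalizing (X : C) (dX : X --> X ⊗ H) (T : C) (t : X ⊗ H --> T)
    : Prop :=
  (t ⊠ idm H) ∘ (dX ⊠ idm H) ∘ dX = (t ⊠ idm H) ∘ tens_comul X ∘ dX.

Definition universally_coequalizes (X : C) (dX : X --> X ⊗ H)
    (XH : C) (piX : X ⊗ H --> XH) : Prop :=
  coequalizing dX piX /\
  forall (T : C) (t : X ⊗ H --> T), coequalizing dX t ->
    exists! u : XH --> T, t = u ∘ piX.

Definition partial_comodule_datum (X XH : C)
    (piX : X ⊗ H --> XH) (rhoX : X --> XH) : Prop := epi piX.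

Definition GPC1 (X XH : C) (piX : X ⊗ H --> XH) (rhoX : X --> XH) : Prop :=
  exists Xeps : XH --> X, Xeps ∘ rhoX = idm X /\ Xeps ∘ piX = tens_counit X.

(* P is (X • H) • H with po_inl P = ρ_X • H and po_inr P = π_{X • H};
   Q is X • (H • H) with po_inl Q = X • Δ and po_inr Q = π_{X,Δ}. *)
Definition GPC2 (po : pushouts_in C) (X XH : C)
    (piX : X ⊗ H --> XH) (rhoX : X --> XH) : Prop :=
  let P := po _ _ _ piX (rhoX ⊠ idm H) in
  let Q := po _ _ _ piX ((piX ⊠ idm H) ∘ tens_comul X) in
  exists theta : po_obj Q --> po_obj P,
    is_iso theta /\
    theta ∘ po_inr Q = po_inr P /\
    theta ∘ po_inl Q ∘ rhoX = po_inl P ∘ rhoX.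

Record geometric_partial_comodule (po : pushouts_in C) (X XH : C)
    (piX : X ⊗ H --> XH) (rhoX : X --> XH) : Prop := GeometricPartialComodule {
  gpc_datum : partial_comodule_datum piX rhoX;
  gpc_counit : GPC1 piX rhoX;
  gpc_coassoc : GPC2 po piX rhoX
}.

End Comodules.

(* Main.v *)
Require Import Defs.
From Corelib Require Import ssreflect.

(** Call a morphism out of [X ⊗ H] coequalizing when it identifies the two
    coassociativity composites of [dX].  Universality of [piX] says exactly that
    a morphism factors through [piX], and then uniquely, if and only if it is
    coequalizing.  Hence [piX] is an epimorphism, and everything reduces to
    deciding which morphisms are coequalizing.

    The counit [X ⊗ ε] is: both composites become [dX], by counitality of [X] on
    one side and of [H] on the other.  The factorization of [X ⊗ ε] is [X • ε].

    For coassociativity, a pushout of [piX] along [f : X ⊗ H --> Y] represents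
    the morphisms [d] out of [Y] such that [d ∘ f] is coequalizing.  The objects
    [(X • H) • H] and [X • (H • H)] are the pushouts of [piX] along
    [(piX ⊗ H) ∘ (dX ⊗ H)] and [(piX ⊗ H) ∘ (X ⊗ Δ)].  These morphisms
    become equal after composition with [dX], and therefore, applying [- ⊗ H],
    their tensor products with [H] become equal after composition with
    [dX ⊗ H]; together with naturality of [X ⊗ Δ] in [X] and coassociativity of
    [H] this shows that a morphism [d] makes the one composite coequalizing
    exactly when it makes the other so ([coequalizing_coaction_iff_comul]).  The
    two pushouts therefore represent the same functor, whence the isomorphism
    [θ] ([pushouts_iso_of_same_factorizations]); its compatibility with
    [piX ∘ dX] is the coequalizing equation of [piX] once more. *)

(** * Pushouts along an epimorphism *)

Section Pushouts.
Context {C : category}.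

Lemma inverse_unique {X Y : C} {f : X --> Y} {g g' : Y --> X} :
  g ∘ f = idm X -> f ∘ g' = idm Y -> g = g'.
Proof.
move=> gf fg'.
by rewrite -(comp_idr g) -fg' comp_assoc gf comp_idl.
Qed.

Lemma pushout_epi {A B D P : C} {f : A --> B} {g : A --> D}
    {i : B --> P} {j : D --> P} :
  is_pushout f g i j -> epi f -> epi j.
Proof.
move=> [comm univ] epif T u v ujvj.
have uivi : u ∘ i = v ∘ i.
  by apply: epif; rewrite -!comp_assoc comm !comp_assoc ujvj.
have cocone : (v ∘ i) ∘ f = (v ∘ j) ∘ g by rewrite -!comp_assoc comm.
have [w [_ uniq]] := univ _ _ _ cocone.
by rewrite -(uniq u (conj uivi ujvj)) (uniq v).
Qed.

Lemma pushout_factor {A B D P T : C} {p : A --> B} {f : A --> D}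
    {i : B --> P} {j : D --> P} (d : D --> T) :
  is_pushout p f i j -> (exists b : B --> T, d ∘ f = b ∘ p) ->
  exists u : P --> T, u ∘ j = d.
Proof.
move=> [_ univ] [b eqb].
have [u [[_ uj] _]] := univ _ _ _ (eq_sym eqb).
by exists u.
Qed.

(** Since [p] is epi, a cocone under [p] and [f] is determined by its leg on [D],
    so the pushout only depends on which [d] have [d ∘ f] factor through [p]. *)
Lemma pushouts_iso_of_same_factorizations {A B D P Q : C}
    {p : A --> B} {f g : A --> D}
    {iP : B --> P} {jP : D --> P} {iQ : B --> Q} {jQ : D --> Q} :
  epi p -> is_pushout p f iP jP -> is_pushout p g iQ jQ ->
  (forall (T : C) (d : D --> T),
     (exists b : B --> T, d ∘ f = b ∘ p) <->
     (exists b : B --> T, d ∘ g = b ∘ p)) ->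
  exists theta : Q --> P, is_iso theta /\ theta ∘ jQ = jP.
Proof.
move=> epip poP poQ same.
have [theta thetaj] : exists theta : Q --> P, theta ∘ jQ = jP.
  apply: (pushout_factor _ poQ); apply/same.
  by exists iP; rewrite (pushout_comm poP).
have [eta etaj] : exists eta : P --> Q, eta ∘ jP = jQ.
  apply: (pushout_factor _ poP); apply/same.
  by exists iQ; rewrite (pushout_comm poQ).
exists theta; split=> //; exists eta; split.
- by apply: (pushout_epi poQ epip); rewrite -comp_assoc thetaj etaj comp_idl.
- by apply: (pushout_epi poP epip); rewrite -comp_assoc etaj thetaj comp_idl.
Qed.

End Pushouts.

(** * Coherence for tensoring with a coalgebra *)

Section Coherence.
Context {C : monoidal_category}.

Lemma assoc_inv_nat {X Y Z X' Y' Z' : C}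
    (f : X --> X') (g : Y --> Y') (h : Z --> Z') :
  assoc_inv X' Y' Z' ∘ (f ⊠ (g ⊠ h)) = ((f ⊠ g) ⊠ h) ∘ assoc_inv X Y Z.
Proof.
rewrite -[LHS]comp_idr -(assoc_invK X Y Z) comp_assoc.
rewrite -(comp_assoc _ _ (assoc X Y Z)) -assoc_nat comp_assoc.
by rewrite assocK comp_idl.
Qed.

Lemma tensm_comp_idl {X Y Z W : C} (g : Y --> Z) (f : X --> Y) :
  idm W ⊠ (g ∘ f) = (idm W ⊠ g) ∘ (idm W ⊠ f).
Proof. by rewrite -tensm_comp comp_idl. Qed.

Lemma tensm_comp_idr {X Y Z W : C} (g : Y --> Z) (f : X --> Y) :
  (g ∘ f) ⊠ idm W = (g ⊠ idm W) ∘ (f ⊠ idm W).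
Proof. by rewrite -tensm_comp comp_idl. Qed.

(** The two sides of the pentagon are isomorphisms, so their inverses agree. *)
Lemma pentagon_inv (X Y Z W : C) :
  assoc_inv (X ⊗ Y) Z W ∘ assoc_inv X Y (Z ⊗ W) =
  (assoc_inv X Y Z ⊠ idm W) ∘ assoc_inv X (Y ⊗ Z) W
    ∘ (idm X ⊠ assoc_inv Y Z W).
Proof.
apply: (@inverse_unique _ _ _ (assoc X Y (Z ⊗ W) ∘ assoc (X ⊗ Y) Z W)).
- rewrite comp_assoc -(comp_assoc _ (assoc_inv X Y (Z ⊗ W))).
  by rewrite assocK comp_idr assocK.
- rewrite pentagon !comp_assoc.
  rewrite -(comp_assoc _ (assoc X Y Z ⊠ idm W)) -tensm_comp_idr.
  rewrite assoc_invK tensm_id comp_idr.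
  rewrite -(comp_assoc _ (assoc X (Y ⊗ Z) W)) assoc_invK comp_idr.
  by rewrite -tensm_comp_idl assoc_invK tensm_id.
Qed.

Variable H : coalgebra C.

Lemma tens_comul_nat {X Y : C} (f : X --> Y) :
  tens_comul H Y ∘ (f ⊠ idm H) = ((f ⊠ idm H) ⊠ idm H) ∘ tens_comul H X.
Proof.
rewrite /tens_comul comp_assoc -assoc_inv_nat -!comp_assoc.
by rewrite -!tensm_comp tensm_id !comp_idl !comp_idr.
Qed.

(** The coassociativity of [H] tensored with [X] lives in [X ⊗ (H ⊗ (H ⊗ H))]; the
    inverse pentagon carries it to [((X ⊗ H) ⊗ H) ⊗ H]. *)
Lemma tens_comul_coassoc (X : C) :
  (tens_comul H X ⊠ idm H) ∘ tens_comul H X =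
  tens_comul H (X ⊗ H) ∘ tens_comul H X.
Proof.
have comul_coassoc_inv : (comul H ⊠ idm H) ∘ comul H =
    assoc_inv H H H ∘ ((idm H ⊠ comul H) ∘ comul H).
  by rewrite -comul_coassoc !comp_assoc assocK comp_idl.
rewrite /tens_comul tensm_comp_idr !comp_assoc.
rewrite -(comp_assoc _ _ (assoc_inv X H H)) -assoc_inv_nat.
rewrite -!comp_assoc -tensm_comp_idl comul_coassoc_inv tensm_comp_idl.
rewrite !comp_assoc -pentagon_inv tensm_comp_idl !comp_assoc.
rewrite -(comp_assoc _ (assoc_inv X H (H ⊗ H))) assoc_inv_nat tensm_id.
by rewrite !comp_assoc.
Qed.

Lemma tens_counit_comul (X : C) :
  (tens_counit H X ⊠ idm H) ∘ tens_comul H X = idm (X ⊗ H).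
Proof.
rewrite /tens_counit /tens_comul tensm_comp_idr -triangle !comp_assoc.
rewrite -(comp_assoc _ (assoc X unit_obj H)) assoc_nat comp_assoc.
rewrite -(comp_assoc _ (assoc X H H)) assoc_invK comp_idr.
by rewrite -!tensm_comp_idl comul_counitl tensm_id.
Qed.

End Coherence.

(** * Coequalizing morphisms *)

Section Coequalizing.
Context {C : monoidal_category} {H : coalgebra C} {X : C} {dX : X --> X ⊗ H}.

Lemma coequalizing_postcomp {T U : C} {t : X ⊗ H --> T} (u : T --> U) :
  coequalizing dX t -> coequalizing dX (u ∘ t).
Proof.
rewrite /coequalizing tensm_comp_idr => eqt.
by rewrite -!(comp_assoc (u ⊠ _)) eqt.
Qed.

(** Both composites are [dX]: [(X ⊗ ε) ∘ dX] is the identity by hypothesis, and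
    [(X ⊗ ε ⊗ H) ∘ (X ⊗ Δ)] is the identity by the left counit law of [H]. *)
Lemma coequalizing_counit : counital dX -> coequalizing dX (tens_counit H X).
Proof.
move=> counitX; rewrite /coequalizing -tensm_comp_idr tens_counit_comul.
by rewrite counitX tensm_id.
Qed.

Section Factorization.
Context {XH : C} {piX : X ⊗ H --> XH}.
Hypothesis piX_univ : universally_coequalizes dX piX.

Lemma factors_iff_coequalizing {T : C} (t : X ⊗ H --> T) :
  (exists u : XH --> T, t = u ∘ piX) <-> coequalizing dX t.
Proof.
have [coeqpi univ] := piX_univ; split=> [[u ->]|coeqt].
- exact: coequalizing_postcomp.
- by have [u [tu _]] := univ _ _ coeqt; exists u.
Qed.

Lemma universally_coequalizing_epi : epi piX.
Proof.
have [coeqpi univ] := piX_univ; move=> T u v uv.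
have [w [_ uniq]] := univ _ _ (coequalizing_postcomp u coeqpi).
by rewrite -(uniq u (eq_refl _)) (uniq v uv).
Qed.

End Factorization.

(** The two coequalizing equations agree side by side. Their sides through
    [(dX ⊗ H) ∘ dX] agree by applying [- ⊗ H] to the equation for [t]. Their sides
    through [(X ⊗ Δ) ∘ dX] agree because both have the form
    [(d ⊗ H) ∘ (T ⊗ Δ) ∘ s] with [s] one of the two sides of the equation for [t]:
    naturality brings [T ⊗ Δ] to the left of [(t ∘ dX) ⊗ H], and coassociativity
    of [H] produces it from [(X ⊗ Δ ⊗ H) ∘ (X ⊗ Δ)]. *)
Lemma coequalizing_coaction_iff_comul {T U : C} {t : X ⊗ H --> T}
    (d : T ⊗ H --> U) :
  coequalizing dX t ->
  coequalizing dX (d ∘ ((t ∘ dX) ⊠ idm H)) <->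
  coequalizing dX (d ∘ ((t ⊠ idm H) ∘ tens_comul H X)).
Proof.
rewrite /coequalizing => eqt.
have outer :
    (((t ∘ dX) ⊠ idm H) ⊠ idm H) ∘ (dX ⊠ idm H) =
    (((t ⊠ idm H) ∘ tens_comul H X) ⊠ idm H) ∘ (dX ⊠ idm H).
  by rewrite -!tensm_comp_idr (tensm_comp_idr t) eqt.
have inner :
    (((t ∘ dX) ⊠ idm H) ⊠ idm H) ∘ tens_comul H X ∘ dX =
    (((t ⊠ idm H) ∘ tens_comul H X) ⊠ idm H) ∘ tens_comul H X ∘ dX.
  rewrite -tens_comul_nat [in LHS]tensm_comp_idr.
  rewrite -[LHS]comp_assoc eqt (tensm_comp_idr (t ⊠ _)).
  rewrite -(comp_assoc _ (tens_comul H X ⊠ idm H)) tens_comul_coassoc.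
  by rewrite !(comp_assoc (tens_comul H T)) tens_comul_nat !(comp_assoc (_ ⊠ _)).
rewrite (tensm_comp_idr d) (tensm_comp_idr d ((t ⊠ _) ∘ _)).
by rewrite -!(comp_assoc (d ⊠ _)) outer inner.
Qed.

End Coequalizing.

(** * The geometric partial comodule *)

Theorem theorem2p9 (C : monoidal_category) (po : pushouts_in C)
    (H : coalgebra C) (X : C) (dX : X --> X ⊗ H) (hdX : counital dX)
    (XH : C) (piX : X ⊗ H --> XH)
    (hpi : universally_coequalizes dX piX) :
  geometric_partial_comodule po piX (piX ∘ dX).
Proof.
have epipi := universally_coequalizing_epi hpi.
have coeqpi := proj1 hpi.
split; first exact: epipi.
- have [Xeps Xeps_pi] :=
    proj2 (factors_iff_coequalizing hpi _) (coequalizing_counit hdX).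
  by exists Xeps; rewrite comp_assoc -Xeps_pi.
- rewrite /GPC2.
  set Q := po _ _ _ _ (_ ∘ tens_comul _ _); set P := po _ _ _ _ _.
  have comP := pushout_comm (po_is_pushout P).
  have comQ := pushout_comm (po_is_pushout Q).
  have [theta [theta_iso theta_inr]] : exists theta : po_obj Q --> po_obj P,
      is_iso theta /\ theta ∘ po_inr Q = po_inr P.
    apply: (pushouts_iso_of_same_factorizations epipi
              (po_is_pushout P) (po_is_pushout Q)) => T d.
    exact: (iff_trans (factors_iff_coequalizing hpi _)
             (iff_trans (coequalizing_coaction_iff_comul d coeqpi)
               (iff_sym (factors_iff_coequalizing hpi _)))).
  exists theta; split=> //; split=> //.
  rewrite !(comp_assoc _ piX) -(comp_assoc theta) comQ comP.
  rewrite (comp_assoc theta) theta_inr -!(comp_assoc (po_inr P)).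
  by congr (_ ∘ _); rewrite tensm_comp_idr coeqpi.
Qed.
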